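(* Let $n\ge 0$ and $\delta t>0$, and assume $c_i^n>0$ for all $i=1,\dots,N$. Let $(\{c_i^{n+1}\}_{i=1}^N,\phi^{n+1})$ be any solution of the time-discrete scheme $$\frac{c_i^{n+1}-c_i^n}{\delta t}=\nabla\cdot\big(D_ic_i^n\nabla\mu_i^{n+1}\big),\qquad \mu_i^{n+1}=\log c_i^{n+1}+z_i(\phi^{n+1}+\phi_e),\qquad i=1,\dots,N,$$ $$-\nabla\cdot(\epsilon\nabla\phi^{n+1})=\rho_0+\sum_{i=1}^Nz_ic_i^{n+1}$$ in $\Omega$, with the boundary conditions on $\mu_i^{n+1}$ and $\phi^{n+1}$ described in the context. Then: 1. (Mass conservation) $\displaystyle\int_\Omega c_i^{n+1}\,d\bm{x}=\int_\Omega c_i^n\,d\bm{x}$ for all $i$. 2. (Positivity) $c_i^{n+1}>0$ for all $i$. 3. (Energy dissipation) $$E^{n+1}-E^n\le-\delta t\int_\Omega\sum_{i=1}^ND_ic_i^n\left|\nabla\mu_i^{n+1}\right|^2d\bm{x},$$ where, for $k\in\{n,n+1\}$, $$E^k=\int_\Omega\sum_{i=1}^Nc_i^k(\log c_i^k-1)+\Big(\rho_0+\sum_{i=1}^Nz_ic_i^k\Big)\Big(\frac12\phi^k+\phi_e\Big)\,d\bm{x}.$$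
   Context: $\Omega\subset\mathbb{R}^d$ ($d=1,2,3$) is a bounded domain (with boundary regular enough for the divergence theorem, and outward unit normal $\bm{n}$; in the periodic case, a box). $N\ge 1$ is the number of species; $z_i\in\mathbb{R}$ (valences), $D_i>0$ (diffusion constants), $\epsilon>0$ (permittivity) and $\rho_0\in\mathbb{R}$ (fixed charge density) are constants; $\phi_e$ is a given bounded continuous function on $\overline\Omega$ (external potential). Boundary conditions: one of the following. (a) Periodic boundary conditions on both $\mu_i$ and $\phi$. (b) The no-flux condition $\partial\mu_i/\partial\bm{n}=0$ on $\partial\Omega$ for all $i$, together with one of the following for $\phi$ on $\partial\Omega$: Dirichlet $\phi=0$; Neumann $\partial\phi/\partial\bm{n}=0$; or Robin $\alpha\phi+\beta\,\partial\phi/\partial\bm{n}=0$ with constants $\alpha,\beta>0$. If $\phi$ has periodic or Neumann boundary conditions, it is also required that $\int_\Omega\phi\,d\bm{x}=0$ and that the system is electrically neutral, $\rho_0+\sum_iz_i\bar c_i=0$, where $\bar c_i$ is the average of $c_i$ over $\Omega$. The potential $\phi^n$ at the old time level is the one associated with $\{c_i^n\}$: $-\nabla\cdot(\epsilon\nabla\phi^n)=\rho_0+\sum_iz_ic_i^n$ in $\Omega$, with the same boundary conditions (and normalization) as $\phi^{n+1}$. Solutions are understood in the classical sense: $c_i^n\in C^1(\overline\Omega)$, $c_i^n>0$ on $\overline\Omega$; $\phi^n,\phi^{n+1},\mu_i^{n+1}\in C^2(\overline\Omega)$; and $c_i^{n+1}$ is a function for which $\log c_i^{n+1}$ is defined.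 In the periodic case the functions are periodic with this regularity. *)

(* Defs.v *)
From HB Require Import structures.
From mathcomp Require Import all_boot all_order all_algebra.
From mathcomp Require Import all_classical all_reals all_analysis.

Set Implicit Arguments.
Unset Strict Implicit.
Unset Printing Implicit Defensive.
Import Order.TTheory GRing.Theory Num.Theory.
Import numFieldNormedType.Exports.

Local Open Scope classical_set_scope.
Local Open Scope ring_scope.

(* As for tuples in the library, R^d carries the sigma-algebra generated by
   the coordinate maps, that is, the Borel sigma-algebra. *)
Section measurable_rV.
Context {R : realType} {d : nat}.

Let coord (i : 'I_d) (x : 'rV[R]_d) : measurableTypeR R := x 0 i.

Let rV_set0 : g_sigma_preimage coord set0.
Proof. exact: sigma_algebra0. Qed.

Let rV_setC A : g_sigma_preimage coord A -> g_sigma_preimage coord (~` A).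
Proof. exact: sigma_algebraC. Qed.

Let rV_bigcup (F : (set 'rV[R]_d)^nat) :
  (forall i, g_sigma_preimage coord (F i)) ->
  g_sigma_preimage coord (\bigcup_i (F i)).
Proof. exact: sigma_algebra_bigcup. Qed.

HB.instance Definition _ := @isMeasurable.Build default_measure_display
  'rV[R]_d (g_sigma_preimage coord) rV_set0 rV_setC rV_bigcup.

Lemma measurable_coord_rV (i : 'I_d) :
  measurable_fun [set: 'rV[R]_d]
    ((fun x => x 0 i) : 'rV[R]_d -> measurableTypeR R).
Proof.
move=> _ B mB; rewrite setTI; apply: sub_sigma_algebra.
rewrite -bigcup_seq/=; exists i => /=; first by rewrite mem_index_enum.
by exists B => //; rewrite setTI.
Qed.

Lemma measurable_to_rV d0 (T : measurableType d0) (f : T -> 'rV[R]_d) :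
  (forall i, measurable_fun setT ((fun x => f x 0 i) : T -> measurableTypeR R)) ->
  measurable_fun setT f.
Proof.
move=> mf.
suff h : g_sigma_preimage (fun i => coord i \o f) `<=` measurable.
  move: h; rewrite g_sigma_preimage_comp => h _ A mA.
  by apply: h; exists A.
apply: smallest_sub; first exact: sigma_algebra_measurable.
rewrite -bigcup_seq/=; apply: bigcup_sub => i _ A [B mB <-].
exact: mf.
Qed.

End measurable_rV.

(* Lebesgue measure on R^d, by recursion on d: the image of the product of the
   measures on R and R^d under (t, v) |-> row_mx t v is the one on R^d.+1. *)
Section lebesgue_rV.
Context {R : realType}.

Definition cons_rV d (p : measurableTypeR R * 'rV[R]_d) : 'rV[R]_d.+1 :=
  row_mx (p.1 : R)%:M p.2.

Let uncons_rV d (x : 'rV[R]_d.+1) : measurableTypeR R * 'rV[R]_d :=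
  (x 0 ord0 : measurableTypeR R, \row_j x 0 (lift ord0 j)).

Let cons_rVK d : cancel (@cons_rV d) (@uncons_rV d).
Proof.
move=> [t v]; rewrite /uncons_rV /cons_rV /=; congr pair.
  have -> : ord0 = lshift d (0 : 'I_1) :> 'I_(1 + d) by apply: val_inj.
  by rewrite (@row_mxEl R 1 1 d) mxE eqxx mulr1n.
apply/rowP => j; rewrite mxE.
have -> : lift ord0 j = rshift 1 j :> 'I_(1 + d) by apply: val_inj.
by rewrite (@row_mxEr R 1 1 d).
Qed.

Lemma measurable_cons_rV d : measurable_fun setT (@cons_rV d).
Proof.
apply: measurable_to_rV => i.
have [j|j] := split_ordP (i : 'I_(1 + d)) => ->.
  apply: (eq_measurable_fun (fst : _ -> measurableTypeR R)) => // p _.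
  by rewrite /cons_rV (@row_mxEl R 1 1 d) mxE ord1 mulr1n.
apply: (eq_measurable_fun
  (((fun x => x 0 j) : 'rV[R]_d -> measurableTypeR R) \o snd)).
  by move=> p _; rewrite /cons_rV (@row_mxEr R 1 1 d).
by apply: measurableT_comp => //; exact: measurable_coord_rV.
Qed.

Let measurable_uncons_rV d : measurable_fun setT (@uncons_rV d).
Proof.
apply: measurable_fun_pair; first exact: measurable_coord_rV.
apply: measurable_to_rV => i.
apply: (eq_measurable_fun
  ((fun x => x 0 (lift ord0 i)) : 'rV[R]_d.+1 -> measurableTypeR R)).
  by move=> x _; rewrite mxE.
exact: measurable_coord_rV.
Qed.

Section base.

Definition lebesgue_rV0 : set 'rV[R]_0 -> \bar R := dirac (0 : 'rV[R]_0).

HB.instance Definition _ := Measure.on lebesgue_rV0.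

Let sigma_finite_lebesgue_rV0 : sigma_finite setT lebesgue_rV0.
Proof.
exists (fun=> setT); first by rewrite bigcup_const//; exists 0%N.
by move=> _; split=> //; rewrite /lebesgue_rV0 diracT ltry.
Qed.

HB.instance Definition _ := Measure_isSigmaFinite.Build _ _ _ lebesgue_rV0
  sigma_finite_lebesgue_rV0.

End base.

Section step.
Variables (d : nat) (m : {sigma_finite_measure set 'rV[R]_d -> \bar R}).

Definition lebesgue_rVS : set 'rV[R]_d.+1 -> \bar R :=
  pushforward (@lebesgue_measure R \x m)%E (@cons_rV d).

Let lebesgue_rVS0 : lebesgue_rVS set0 = 0%E.
Proof. by rewrite /lebesgue_rVS /pushforward preimage_set0 measure0. Qed.

Let lebesgue_rVS_ge0 A : (0 <= lebesgue_rVS A)%E.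
Proof. by rewrite /lebesgue_rVS /pushforward; exact: measure_ge0. Qed.

Let lebesgue_rVS_sigma_additive : semi_sigma_additive lebesgue_rVS.
Proof.
move=> F mF tF mUF; rewrite /lebesgue_rVS /pushforward preimage_bigcup.
apply: measure_semi_sigma_additive.
- by move=> n; rewrite -[X in measurable X]setTI; exact: measurable_cons_rV.
- apply/trivIsetP => /= i j _ _ ij; rewrite -preimage_setI.
  by move/trivIsetP : tF => /(_ _ _ _ _ ij) ->//; rewrite preimage_set0.
- rewrite -preimage_bigcup -[X in measurable X]setTI.
  exact: measurable_cons_rV.
Qed.

HB.instance Definition _ := isMeasure.Build _ _ _ lebesgue_rVS
  lebesgue_rVS0 lebesgue_rVS_ge0 lebesgue_rVS_sigma_additive.

Let sigma_finite_lebesgue_rVS : sigma_finite setT lebesgue_rVS.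
Proof.
have [F TF Foo] : sigma_finite setT (@lebesgue_measure R \x m)%E.
  have /sigma_finiteP[F [TF ndF Foo]] := sigma_finiteT (@lebesgue_measure R).
  have /sigma_finiteP[G [TG ndG Goo]] := sigma_finiteT m.
  exists (fun n => F n `*` G n).
    rewrite -setXTT TF TG predeqE => -[x y]; split.
      move=> [/= [n _ Fnx] [k _ Gky]]; exists (maxn n k) => //; split.
      - by move: x Fnx; exact/subsetPset/ndF/leq_maxl.
      - by move: y Gky; exact/subsetPset/ndG/leq_maxr.
    by move=> [n _ []/= ? ?]; split; exists n.
  move=> k; have [? ?] := Foo k; have [? ?] := Goo k.
  split; first exact: measurableX.
  by rewrite product_measure1E// lte_mul_pinfty// ge0_fin_numE.
exists (fun n => @uncons_rV d @^-1` F n).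
  by rewrite -preimage_bigcup -TF preimage_setT.
move=> n; have [mF Fy] := Foo n; split.
  by rewrite -[X in measurable X]setTI; exact: measurable_uncons_rV.
rewrite /lebesgue_rVS /pushforward -comp_preimage.
by rewrite (_ : _ \o _ = id) ?preimage_id//; apply/funext => p; exact: cons_rVK.
Qed.

HB.instance Definition _ := Measure_isSigmaFinite.Build _ _ _ lebesgue_rVS
  sigma_finite_lebesgue_rVS.

End step.

Fixpoint lebesgue_rV d : {sigma_finite_measure set 'rV[R]_d -> \bar R} :=
  if d is d'.+1 then lebesgue_rVS (lebesgue_rV d') else lebesgue_rV0.

Lemma lebesgue_rV_rectangle d (A : 'I_d -> set (measurableTypeR R)) :
  (forall i, measurable (A i)) ->
  lebesgue_rV d [set x : 'rV[R]_d | forall i, A i (x 0 i)] =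
  (\big[*%E/1%E]_i lebesgue_measure (A i))%E.
Proof.
elim: d A => [|d IH] A mA.
  by rewrite big_ord0 /= /lebesgue_rV0 diracE mem_set// => -[].
rewrite big_ord_recl -IH// /= /lebesgue_rVS /pushforward.
rewrite -[RHS]product_measure1E//; last first.
  rewrite (_ : mkset _ = \bigcap_(i in [set: 'I_d])
      (((fun x => x 0 i) : 'rV[R]_d -> measurableTypeR R) @^-1`
        A (lift ord0 i))); last first.
    by apply/seteqP; split=> [x xA i _|x xA i]; [exact: xA|exact: (xA i I)].
  apply: fin_bigcap_measurable => // i _.
  by rewrite -[X in measurable X]setTI; exact: measurable_coord_rV.
congr (product_measure1 _ _ _).
have h (p : measurableTypeR R * 'rV[R]_d) :
    (cons_rV p 0 ord0 = p.1) * (forall i, cons_rV p 0 (lift ord0 i) = p.2 0 i).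
  have := cons_rVK p; rewrite /uncons_rV; case: p => t v [e1 e2] /=.
  by split=> // i; move/rowP : e2 => /(_ i); rewrite mxE.
apply/seteqP; split=> [p pA|p [pA0 pA] i] /=.
  by split=> [|i]; [rewrite -(h p).1|rewrite -(h p).2]; exact: pA.
by case: (unliftP ord0 i) => [j ->|->]; rewrite ?(h p).1 ?(h p).2//; exact: pA.
Qed.

End lebesgue_rV.

Section calculus.
Context {R : realType} {d : nat}.
Implicit Types (Omega : set 'rV[R]_d) (f : 'rV[R]_d -> R)
  (F : 'rV[R]_d -> 'rV[R]_d) (x : 'rV[R]_d) (j : 'I_d).

Definition partial j f : 'rV[R]_d -> R := fun x => 'D_(delta_mx 0 j) f x.

Definition grad f : 'rV[R]_d -> 'rV[R]_d := fun x => \row_j partial j f x.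

Definition divergence F : 'rV[R]_d -> R :=
  fun x => \sum_j partial j (fun y => F y 0 j) x.

(* Euclidean; the norm `|_| of 'rV[R]_d is the supremum norm. *)
Definition dotp (u v : 'rV[R]_d) : R := \sum_j u 0 j * v 0 j.

Definition boundary Omega : set 'rV[R]_d := closure Omega `\` interior Omega.

Definition has_extension Omega f :=
  exists g, {within closure Omega, continuous g} /\ {in Omega, f =1 g}.

Fixpoint derivatives_extend Omega k f : Prop :=
  has_extension Omega f /\
  if k is k'.+1 then
    forall j, (forall x, Omega x -> derivable f x (delta_mx 0 j)) /\
              derivatives_extend Omega k' (partial j f)
  else True.

(* f \in C^k(closure Omega), Omega open: the partial derivatives of f in Omega
   up to order k extend continuously to the closure, and f itself is its
   own extension.  For Omega = setT this is C^k(R^d). *)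
Definition Ck_closure Omega k f :=
  {within closure Omega, continuous f} /\ derivatives_extend Omega k f.

(* The value at x \in closure Omega of the continuous extension of f|Omega. *)
Definition extend Omega f x : R := lim (f y @[y --> within Omega (nbhs x)]).

Definition grad_closure Omega f : 'rV[R]_d -> 'rV[R]_d :=
  fun x => \row_j extend Omega (partial j f) x.

Definition domain Omega :=
  [/\ bounded_set Omega, open Omega, connected Omega & Omega !=set0].

(* Surface measure and outward unit normal of a boundary regular enough for the
   divergence theorem.  The last three fields determine the surface measure on
   the boundary, and the normal up to a surface-null set (polar decomposition
   of the vector measure normal * surface); the sign in the last one is what
   makes the normal point outwards. *)
Record gauss_boundary Omega := GaussBoundary {
  surface : {finite_measure set 'rV[R]_d -> \bar R};
  normal : 'rV[R]_d -> 'rV[R]_d;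
  measurable_normal : measurable_fun setT normal;
  normal_unit :
    {ae surface, forall x, boundary Omega x -> dotp (normal x) (normal x) = 1};
  divergence_theorem : forall F,
    (forall j, Ck_closure Omega 1 (fun x => F x 0 j)) ->
    \int[lebesgue_rV d]_(x in Omega) divergence F x =
    \int[surface]_(x in boundary Omega) dotp (F x) (normal x)
}.

Definition normal_derivative Omega (G : gauss_boundary Omega) f x : R :=
  dotp (grad_closure Omega f x) (normal G x).

Definition box (a b : 'rV[R]_d) : set 'rV[R]_d :=
  [set x | forall j, a 0 j < x 0 j < b 0 j].

Definition box_periodic (a b : 'rV[R]_d) f :=
  forall x j, f (x + (b 0 j - a 0 j) *: delta_mx 0 j) = f x.

Definition average Omega f : R :=
  (\int[lebesgue_rV d]_(x in Omega) f x) / fine (lebesgue_rV d Omega).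

End calculus.

Section boundary_conditions.
Context {R : realType} {d : nat}.
Implicit Types (Omega : set 'rV[R]_d).

Variant potential_condition : Type :=
  | Dirichlet
  | Neumann
  | Robin (alpha beta : R) of 0 < alpha & 0 < beta.

Variant boundary_condition Omega : Type :=
  | Periodic (a b : 'rV[R]_d) of
      (forall j, a 0 j < b 0 j) & Omega = box a b
  | NoFlux (G : gauss_boundary Omega) of potential_condition.

(* In the periodic case functions are periodic functions on R^d. *)
Definition regular Omega (bc : boundary_condition Omega) k
    (f : 'rV[R]_d -> R) : Prop :=
  match bc with
  | Periodic a b _ _ => Ck_closure setT k f /\ box_periodic a b f
  | NoFlux _ _ => Ck_closure Omega k f
  end.

(* Conditions on normal derivatives are required at almost every boundary
   point, the normal being defined only there. *)
Definition mu_condition Omega (bc : boundary_condition Omega)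
    (mu : 'rV[R]_d -> R) : Prop :=
  match bc with
  | Periodic a b _ _ => box_periodic a b mu
  | NoFlux G _ => {ae surface G, forall x, boundary Omega x ->
      normal_derivative G mu x = 0}
  end.

Definition phi_condition Omega (bc : boundary_condition Omega)
    (phi : 'rV[R]_d -> R) : Prop :=
  match bc with
  | Periodic a b _ _ =>
      box_periodic a b phi /\ \int[lebesgue_rV d]_(x in Omega) phi x = 0
  | NoFlux G Dirichlet => forall x, boundary Omega x -> phi x = 0
  | NoFlux G Neumann =>
      {ae surface G, forall x, boundary Omega x ->
        normal_derivative G phi x = 0} /\
      \int[lebesgue_rV d]_(x in Omega) phi x = 0
  | NoFlux G (Robin alpha beta _ _) =>
      {ae surface G, forall x, boundary Omega x ->
        alpha * phi x + beta * normal_derivative G phi x = 0}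
  end.

Definition neutrality_required Omega (bc : boundary_condition Omega) : bool :=
  match bc with
  | Periodic _ _ _ _ | NoFlux _ Neumann => true
  | _ => false
  end.

End boundary_conditions.

Section scheme.
Context {R : realType} {d N : nat}.
Implicit Types (Omega : set 'rV[R]_d) (c : 'I_N -> 'rV[R]_d -> R)
  (phi : 'rV[R]_d -> R).

(* l is the logarithm of y.  Unlike the library function ln, which is total
   (ln y = 0 for y <= 0), this holds for no l when y <= 0. *)
Definition is_log (y l : R) := expR l = y.

Definition neutral Omega (rho0 : R) (z : 'I_N -> R) c :=
  rho0 + \sum_i z i * average Omega (c i) = 0.

Definition poisson Omega (eps rho0 : R) (z : 'I_N -> R) c phi :=
  forall x, Omega x ->
    - divergence (fun y => eps *: grad phi y) x =
    rho0 + \sum_i z i * c i x.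

Definition energy Omega (rho0 : R) (z : 'I_N -> R) (phie : 'rV[R]_d -> R)
    c phi : R :=
  \int[lebesgue_rV d]_(x in Omega)
    (\sum_i c i x * (ln (c i x) - 1) +
     (rho0 + \sum_i z i * c i x) * (2^-1 * phi x + phie x)).

End scheme.

(* Main.v *)
(* Testing the equation of c_i with mu_i and with 1, and integrating by parts,
   gives the dissipation term and mass conservation; positivity is built into
   the logarithm.  Convexity of y (log y - 1) bounds the entropy difference by
   the integral of the sum of (c_i' - c_i) log c_i', and by the Poisson equation
   the electric part of what remains of E' - E is the integral of
     - eps/2 |grad (phi' - phi)|^2
     + eps/2 div(phi' grad phi' - 2 phi' grad phi + phi grad phi).
   The divergence integrates to 0 under periodic, Dirichlet and Neumann
   conditions, and to a nonpositive multiple of the integral of (phi' - phi)^2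
   over the boundary under Robin conditions. *)

Require Import Defs.
From mathcomp Require Import all_boot all_order all_algebra.
From mathcomp Require Import all_classical all_reals all_analysis.
From mathcomp Require Import measurable_realfun ring lra.

Set Implicit Arguments.
Unset Strict Implicit.
Unset Printing Implicit Defensive.
Import Order.TTheory GRing.Theory Num.Theory.
Import numFieldNormedType.Exports.

Local Open Scope classical_set_scope.
Local Open Scope ring_scope.

(** * Borel sets and integrability on R^d *)

Section borel_rV.
Context {R : realType} {d : nat}.
Implicit Types (A B : set 'rV[R]_d) (f : 'rV[R]_d -> R).

Lemma measurable_ball_rV (x : 'rV[R]_d) (e : R) : measurable (ball x e).
Proof.
(* A ball includes the condition [0 < e], which the intersection over coordinates below would lose
   in dimension 0. *)
have [e0|e0] := leP e 0.
  by rewrite (_ : ball x e = set0) // -subset0 => y []; rewrite ltNge e0.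
rewrite (_ : ball x e = \bigcap_(j in [set: 'I_d])
    ((fun y => y 0 j) : 'rV[R]_d -> measurableTypeR R) @^-1` ball (x 0 j) e).
  apply: fin_bigcap_measurable => // j _.
  rewrite -[X in measurable X]setTI; apply: measurable_coord_rV => //.
  by apply: open_measurable; exact: ball_open.
apply/seteqP; split=> [y [_ xy] j _|y xy]; first exact: xy.
by split=> // i j; rewrite (ord1 i); exact: xy.
Qed.

(** Second countability: an open set is the union of the balls with rational centre and radius
    1/(k+1) that it contains. Measurability of these comes from the coordinates, which generate the
    sigma-algebra. *)
Lemma open_measurable_rV A : open A -> measurable A.
Proof.
move=> oA.
pose C (p : 'rV[rat]_d * nat) :=
  ball (map_mx ratr p.1 : 'rV[R]_d) (p.2.+1%:R^-1).
pose F n : set 'rV[R]_d := if unpickle n is Some p then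
  (if `[< C p `<=` A >] then C p else set0) else set0.
rewrite (_ : A = \bigcup_n F n).
  apply: bigcupT_measurable => n; rewrite /F.
  case: (unpickle n) => [p|]; last exact: measurable0.
  by case: asboolP => _; [exact: measurable_ball_rV|exact: measurable0].
apply/seteqP; split=> [x Ax|x [n _]]; last first.
  rewrite /F; case: (unpickle n) => [p|//].
  by case: asboolP => // + Cx; exact.
have /nbhs_ballP[e /= e0 xeA] : nbhs x A by exact: open_nbhs_nbhs.
(* With radius below e/2, a ball that contains x lies in [ball x e] by the triangle inequality,
   wherever its centre is. *)
have [k ke] : exists k, k.+1%:R^-1 < e / 2 :> R.
  have e20 : 0 < e / 2 by rewrite divr_gt0.
  have [k _ /(_ k (leqnn k)) /= ke] := near_infty_natSinv_lt (PosNum e20).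
  by exists k.
have k0 : 0 < k.+1%:R^-1 :> R by rewrite invr_gt0.
have /choice[q qx] j : exists q : rat, ball (ratr q : R) k.+1%:R^-1 (x 0 j).
  have /rat_in_itvoo[q qx] : x 0 j - k.+1%:R^-1 < x 0 j + k.+1%:R^-1.
    by rewrite ltrD2l (lt_trans _ k0)// oppr_lt0.
  exists q; rewrite /ball /= ltr_distl.
  by move: qx; rewrite in_itv /=.
exists (pickle (\row_j q j, k)) => //; rewrite /F pickleK.
have Cx : C (\row_j q j, k) x.
  by split=> // i j; rewrite (ord1 i) !mxE; exact: qx.
case: asboolP => // -[] y Cy; apply: xeA.
apply: (le_ball _ (ball_triangle (ball_sym Cx) Cy)).
by rewrite [leRHS]splitr lerD// ltW.
Qed.

Lemma within_continuous_measurable_rV B f :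
  measurable B -> {within B, continuous f} -> measurable_fun B f.
Proof.
move=> mB /continuousP cf; apply: (measurability _ (RGenOpens.measurableE R)).
move=> _ [_ [a [b ->] <-]].
have /open_subspaceP[V oV VB] :=
  cf _ (@interval_open _ (BRight a) (BLeft b) isT isT).
by rewrite setIC -VB; apply: measurableI => //; exact: open_measurable_rV.
Qed.

(** B is compact, so f is bounded on it, and A has finite measure. The measure is left general to
    serve both the volume of Omega and the surface measure of its boundary. *)
Lemma within_continuous_integrable_rV
    (m : {measure set 'rV[R]_d -> \bar R}) A B f :
  bounded_set B -> closed B -> measurable A -> A `<=` B -> (m A < +oo)%E ->
  {within B, continuous f} -> m.-integrable A (EFin \o f).
Proof.
move=> bB cB mA AB Afin cf; apply: measurable_bounded_integrable => //.
  apply: within_continuous_measurable_rV => //.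
  exact: continuous_subspaceW cf.
have /compact_bounded[M [Mr fM]] :=
  continuous_compact cf (bounded_closed_compact bB cB).
by exists M; split=> // r /fM rM x Ax; apply: rM; exists x => //; exact: AB.
Qed.

Lemma bounded_set_closure A : bounded_set A -> bounded_set (closure A).
Proof.
move=> [M [Mr AM]]; exists M; split=> // r /AM rA.
have cl : closed [set y : 'rV[R]_d | `|y| <= r].
  rewrite (_ : mkset _ = Num.norm @^-1` [set t | t <= r])//.
  by apply: closed_comp; [move=> y _; exact: norm_continuous|exact: closed_le].
by move=> x /(closure_subset rA); rewrite -(closure_id _).1.
Qed.

Lemma bounded_lebesgue_rV A : measurable A -> bounded_set A ->
  (lebesgue_rV d A < +oo)%E.
Proof.
move=> mA [M [Mr /(_ (M + 1)) AM]].
have {}AM x : A x -> `|x| <= M + 1 by apply: AM; rewrite ltrDl.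
pose I : set (measurableTypeR R) := `[- (M + 1), M + 1]%classic.
have mI : measurable I by exact: measurable_itv.
(* A lies in this cube because the norm is the supremum norm; the volume of the cube is a finite
   product of lengths. *)
pose J : set 'rV[R]_d := [set x | forall j, I (x 0 j)].
have mJ : measurable J.
  rewrite (_ : J = \bigcap_(j in [set: 'I_d])
      ((fun x => x 0 j) : 'rV[R]_d -> measurableTypeR R) @^-1` I).
    apply: fin_bigcap_measurable => // j _.
    by rewrite -[X in measurable X]setTI; exact: measurable_coord_rV.
  by apply/seteqP; split=> [x + j _|x + j]; exact.
have /le_lt_trans : (lebesgue_rV d A <= lebesgue_rV d J)%E.
  apply: le_measure; [exact: mem_set|exact: mem_set|].
  move=> x Ax j; rewrite /I /= in_itv /= -ler_norml.
  apply: le_trans (AM x Ax); rewrite [leRHS]/Num.norm /= mx_normrE.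
  exact: (le_bigmax _ (fun i : 'I_1 * 'I_d => `|x i.1 i.2|) (0, j)).
apply; rewrite (lebesgue_rV_rectangle (A := fun=> I))//.
suff : (\big[*%E/1%E]_(j < d) lebesgue_measure I)%E \is a fin_num.
  by rewrite fin_numElt => /andP[].
elim/big_ind : _ => // [x y|j _]; first exact: fin_numM.
by rewrite /I lebesgue_measure_itv; case: ifP.
Qed.

End borel_rV.

(** * Functions with a continuous extension to the closure *)

Section extension.
Context {R : realType} {d : nat}.
Implicit Types (Omega : set 'rV[R]_d) (f g w v : 'rV[R]_d -> R)
  (x : 'rV[R]_d) (j k : 'I_d).

Lemma eq_has_extension Omega f g : (forall x, Omega x -> f x = g x) ->
  has_extension Omega f -> has_extension Omega g.
Proof.
move=> fg [h [ch fh]]; exists h; split=> // x xO.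
by rewrite -fg ?fh//; exact: set_mem.
Qed.

Lemma within_has_extension Omega f :
  {within closure Omega, continuous f} -> has_extension Omega f.
Proof. by move=> cf; exists f. Qed.

Lemma has_extension_cst Omega (r : R) : has_extension Omega (fun=> r).
Proof. by apply: within_has_extension => x; exact: cvg_cst. Qed.

Lemma has_extensionD Omega f g : has_extension Omega f ->
  has_extension Omega g -> has_extension Omega (fun x => f x + g x).
Proof.
move=> [f' [cf ff']] [g' [cg gg']]; exists (fun x => f' x + g' x); split.
  by move=> x; exact: (continuousD (cf x) (cg x)).
by move=> x xO; rewrite ff'// gg'.
Qed.

Lemma has_extensionM Omega f g : has_extension Omega f ->
  has_extension Omega g -> has_extension Omega (fun x => f x * g x).
Proof.
move=> [f' [cf ff']] [g' [cg gg']]; exists (fun x => f' x * g' x); split.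
  by move=> x; exact: (continuousM (cf x) (cg x)).
by move=> x xO; rewrite ff'// gg'.
Qed.

Lemma has_extensionZ Omega (r : R) f :
  has_extension Omega f -> has_extension Omega (fun x => r * f x).
Proof. by move=> ef; apply: has_extensionM => //; exact: has_extension_cst. Qed.

Lemma has_extensionB Omega f g : has_extension Omega f ->
  has_extension Omega g -> has_extension Omega (fun x => f x - g x).
Proof.
move=> ef eg; apply: has_extensionD => //.
apply: eq_has_extension (has_extensionZ (-1) eg) => x _.
by rewrite mulN1r.
Qed.

Lemma has_extension_sum n Omega (F : 'I_n -> 'rV[R]_d -> R) :
  (forall i, has_extension Omega (F i)) ->
  has_extension Omega (fun x => \sum_i F i x).
Proof.
elim: n F => [|n IH] F eF.
  apply: eq_has_extension (has_extension_cst Omega 0) => x _.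
  by rewrite big_ord0.
apply: eq_has_extension (has_extensionD
    (IH (fun i => F (widen_ord (leqnSn n) i)) _) (eF ord_max)).
  by move=> x _; rewrite big_ord_recr.
by move=> i; exact: eF.
Qed.

Lemma has_extension_comp Omega (h : R -> R) f : continuous h ->
  has_extension Omega f -> has_extension Omega (fun x => h (f x)).
Proof.
move=> ch [f' [/subspace_continuousP cf ff']]; exists (h \o f'); split.
  apply/subspace_continuousP => x Ox.
  by apply: (@cvg_comp _ _ _ f' _ _ (nbhs (f' x))); [exact: cf|exact: ch].
by move=> x xO; rewrite ff'.
Qed.

(** [ln] is continuous only at positive arguments, so positivity is required on the closure and not
    just in Omega. *)
Lemma has_extension_ln Omega f : {within closure Omega, continuous f} ->
  (forall x, closure Omega x -> 0 < f x) ->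
  has_extension Omega (fun x => ln (f x)).
Proof.
move=> /subspace_continuousP cf f0; apply: within_has_extension.
apply/subspace_continuousP => x Ox.
apply: (@cvg_comp _ _ _ f _ _ (nbhs (f x))).
  exact: cf.
exact: continuous_ln (f0 _ Ox).
Qed.

(* [extend] is a limit along the trace of the neighbourhood filter, proper only
   at the points of the closure. *)
Lemma extendE Omega f g x : {within closure Omega, continuous g} ->
  {in Omega, f =1 g} -> closure Omega x -> extend Omega f x = g x.
Proof.
move=> /subspace_continuousP cg fg Ox.
have ? := within_nbhs_proper Ox.
apply: cvg_lim => //.
apply: (@cvg_trans _ (g y @[y --> within Omega (nbhs x)])).
  by apply: fmap_within_eq => y /set_mem yO; rewrite fg// mem_set.
apply: (cvg_trans _ (cg x Ox)); apply: cvg_app.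
by apply: within_subset; exact: subset_closure.
Qed.

(** By [extendE] the limit agrees on the closure with any given continuous extension, and inherits
    its continuity. *)
Lemma extend_within Omega f : has_extension Omega f ->
  {within closure Omega, continuous (extend Omega f)}.
Proof.
move=> [g [cg fg]]; apply: subspace_eq_continuous (cg) => x /set_mem Ox.
exact/esym/extendE.
Qed.

Lemma extend_in Omega f x : has_extension Omega f -> Omega x ->
  extend Omega f x = f x.
Proof.
move=> [g [cg fg]] Ox; rewrite (fg x (mem_set Ox)); apply: extendE => //.
exact: subset_closure.
Qed.

(** * Partial derivatives and the classes C^k up to the boundary *)

Lemma eq_partial_open Omega f g j : open Omega ->
  (forall x, Omega x -> f x = g x) ->
  forall x, Omega x -> partial j f x = partial j g x.
Proof.
move=> oO fg x Ox; apply: near_eq_derive.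
by near do apply: fg; exact: open_nbhs_nbhs.
Unshelve. all: by end_near. Qed.

Lemma eq_derivable_open Omega f g : open Omega ->
  (forall x, Omega x -> f x = g x) ->
  forall x u, Omega x -> derivable f x u -> derivable g x u.
Proof.
move=> oO fg x u Ox; apply: near_eq_derivable.
by near do apply: fg; exact: open_nbhs_nbhs.
Unshelve. all: by end_near. Qed.

Lemma eq_divergence_open Omega (F G : 'rV[R]_d -> 'rV[R]_d) : open Omega ->
  (forall x, Omega x -> F x = G x) ->
  forall x, Omega x -> divergence F x = divergence G x.
Proof.
move=> oO FG x Ox; apply: eq_bigr => j _.
by apply: (eq_partial_open _ oO) => // y Oy; rewrite FG.
Qed.

Lemma Ck_closure_has_extension Omega n f :
  Ck_closure Omega n f -> has_extension Omega f.
Proof. by case=> /within_has_extension. Qed.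

Lemma Ck_closure_partial Omega n f j : Ck_closure Omega n.+1 f ->
  (forall x, Omega x -> derivable f x (delta_mx 0 j)) /\
  derivatives_extend Omega n (partial j f).
Proof. by case=> _ /= [_ /(_ j)]. Qed.

Lemma Ck_closure_partial_extension Omega n f j : Ck_closure Omega n.+1 f ->
  has_extension Omega (partial j f).
Proof. by move=> /Ck_closure_partial - /(_ j)[_]; case: n => [|n] []. Qed.

(** Periodic functions live on all of R^d; restricting them lets the periodic case share every
    estimate stated on the closure of Omega. *)
Lemma Ck_closureT Omega n f : Ck_closure setT n f -> Ck_closure Omega n f.
Proof.
have ext g : has_extension setT g -> has_extension Omega g.
  move=> [h [ch gh]]; exists h; split; last by move=> x _; rewrite gh ?inE.
  by apply: continuous_subspaceW ch; rewrite closureT.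
move=> [cf df]; split.
  by apply: continuous_subspaceW cf; rewrite closureT.
elim: n f df {cf} => [|n IH] f [ef df]; split; try exact: ext.
  by [].
move=> j; have [jf /IH] := df j.
by split=> // x _; exact: jf.
Qed.

Lemma partialM f g j x :
  derivable f x (delta_mx 0 j) -> derivable g x (delta_mx 0 j) ->
  partial j (fun y => f y * g y) x = f x * partial j g x + g x * partial j f x.
Proof. by move=> df dg; rewrite /partial (deriveM df dg). Qed.

Lemma Ck_closure1M Omega f g : open Omega -> Ck_closure Omega 1 f ->
  Ck_closure Omega 1 g -> Ck_closure Omega 1 (fun x => f x * g x).
Proof.
move=> oO Cf Cg.
have cfg : {within closure Omega, continuous (fun x => f x * g x)}.
  by move=> x; exact: (continuousM (Cf.1 x) (Cg.1 x)).
split=> //; split; first exact: within_has_extension.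
move=> j; have [df _] := Ck_closure_partial j Cf.
have [dg _] := Ck_closure_partial j Cg.
split=> [x Ox|]; first by apply: derivableM; [exact: df|exact: dg].
split=> //.
apply: (@eq_has_extension _
    (fun x => f x * partial j g x + g x * partial j f x)).
  by move=> x Ox; rewrite partialM//; [exact: df|exact: dg].
apply: has_extensionD; apply: has_extensionM.
- exact: Ck_closure_has_extension Cf.
- exact: Ck_closure_partial_extension Cg.
- exact: Ck_closure_has_extension Cg.
- exact: Ck_closure_partial_extension Cf.
Qed.

Lemma Ck_closure1Z Omega (r : R) f : open Omega ->
  Ck_closure Omega 1 f -> Ck_closure Omega 1 (fun x => r * f x).
Proof.
move=> oO; apply: Ck_closure1M => //; split.
  by move=> x; exact: cvg_cst.
split=> [|j]; first exact: has_extension_cst.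
split=> [x _|]; first exact: derivable_cst.
split=> //; apply: eq_has_extension (has_extension_cst Omega 0) => x _.
by rewrite /partial derive_cst.
Qed.

Lemma Ck_closure21 Omega f : Ck_closure Omega 2 f -> Ck_closure Omega 1 f.
Proof.
move=> Cf; split; first exact: Cf.1.
split; first exact: Ck_closure_has_extension Cf.
move=> j; split; first exact: (Ck_closure_partial j Cf).1.
by split=> //; exact: Ck_closure_partial_extension Cf.
Qed.

(** The divergence theorem asks for a field continuous on the closure, while [partial j f] is
    controlled only inside Omega. Its continuous extension has the same derivatives there, since
    they depend only on values near a point of the open set. *)
Lemma Ck_closure_extend_partial Omega f j : open Omega ->
  Ck_closure Omega 2 f -> Ck_closure Omega 1 (extend Omega (partial j f)).
Proof.
move=> oO Cf; have ej := Ck_closure_partial_extension j Cf.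
have [_ [_ dj]] := Ck_closure_partial j Cf.
have cj := extend_within ej.
have eqj x : Omega x -> partial j f x = extend Omega (partial j f) x.
  by move=> Ox; rewrite extend_in.
split=> //; split; first exact: within_has_extension.
move=> k; have [djk [ejk _]] := dj k; split=> [x Ox|].
  exact: (eq_derivable_open oO eqj Ox (djk x Ox)).
split=> //.
exact: eq_has_extension (eq_partial_open k oO eqj) ejk.
Qed.

(** * Laplacian, divergence and Euclidean product identities *)

Definition laplacian f x := \sum_j partial j (partial j f) x.

Lemma has_extension_laplacian Omega f :
  Ck_closure Omega 2 f -> has_extension Omega (laplacian f).
Proof.
move=> Cf; apply: has_extension_sum => j.
by have [_ [_ /(_ j)[_ []]]] := Ck_closure_partial j Cf.
Qed.

Lemma has_extension_dotp_grad Omega f g : Ck_closure Omega 1 f ->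
  Ck_closure Omega 1 g ->
  has_extension Omega (fun x => dotp (grad f x) (grad g x)).
Proof.
move=> Cf Cg; apply: has_extension_sum => j.
apply: (@eq_has_extension _ (fun x => partial j f x * partial j g x)).
  by move=> x _; rewrite !mxE.
by apply: has_extensionM;
  [exact: Ck_closure_partial_extension Cf
  |exact: Ck_closure_partial_extension Cg].
Qed.

Lemma divergence_scale_grad Omega w v x :
  Ck_closure Omega 1 w -> Ck_closure Omega 2 v -> Omega x ->
  divergence (fun y => w y *: grad v y) x =
  w x * laplacian v x + dotp (grad w x) (grad v x).
Proof.
move=> Cw Cv Ox; rewrite /laplacian /dotp mulr_sumr -big_split/=.
apply: eq_bigr => j _.
rewrite [X in partial j X](_ : _ = fun y => w y * partial j v y); last first.
  by apply/funext => y; rewrite !mxE.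
have [dw _] := Ck_closure_partial j Cw.
have [_ [_ /(_ j)[dv _]]] := Ck_closure_partial j Cv.
rewrite partialM; [|exact: dw|exact: dv].
by rewrite !mxE mulrC [X in _ + X]mulrC.
Qed.

Lemma dotp_ge0 (u : 'rV[R]_d) : 0 <= dotp u u.
Proof. by apply: sumr_ge0 => j _; rewrite -expr2 sqr_ge0. Qed.

Lemma dotpBB (u v : 'rV[R]_d) :
  dotp (u - v) (u - v) = dotp u u - 2 * dotp u v + dotp v v.
Proof.
rewrite /dotp mulr_sumr -sumrB -big_split/=; apply: eq_bigr => j _.
by rewrite !mxE; ring.
Qed.

Lemma dotpZl (a : R) (u v : 'rV[R]_d) : dotp (a *: u) v = a * dotp u v.
Proof.
by rewrite /dotp mulr_sumr; apply: eq_bigr => j _; rewrite mxE mulrA.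
Qed.

End extension.

(** * The divergence theorem for periodic functions *)

Section slices.
Context {R : realType}.

Lemma continuous_to_rV (T : topologicalType) n (F : T -> 'rV[R]_n) :
  (forall j, continuous (fun x => F x 0 j)) -> continuous F.
Proof.
move=> cF x A [P FxP PA].
suff : \forall y \near x, forall i j, P i j (F y i j).
  by apply: filterS => y /PA.
apply: filter_forall => i; apply: filter_forall => j.
by rewrite (ord1 i); apply: cF; rewrite -(ord1 i); exact: FxP.
Qed.

Lemma cons_rV0 n (t : R) (v : 'rV[R]_n) : cons_rV (t, v) 0 ord0 = t.
Proof.
rewrite /cons_rV (_ : ord0 = lshift n (0 : 'I_1) :> 'I_(1 + n)).
  by rewrite (@row_mxEl R 1 1 n) mxE eqxx mulr1n.
exact: val_inj.
Qed.

Lemma cons_rVS n (t : R) (v : 'rV[R]_n) j :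
  cons_rV (t, v) 0 (lift ord0 j) = v 0 j.
Proof.
rewrite /cons_rV (_ : lift ord0 j = rshift 1 j :> 'I_(1 + n)).
  by rewrite (@row_mxEr R 1 1 n).
exact: val_inj.
Qed.

Lemma continuous_cons_rVr n (t : R) :
  continuous (fun v : 'rV[R]_n => cons_rV (t, v)).
Proof.
apply: continuous_to_rV => i; have [j ->|->] := unliftP ord0 i.
  rewrite (_ : (fun v => _) = fun v : 'rV[R]_n => v 0 j).
    exact: coord_continuous.
  by apply/funext => v; rewrite cons_rVS.
rewrite (_ : (fun v => _) = cst t); first exact: cst_continuous.
by apply/funext => v; rewrite cons_rV0.
Qed.

Lemma continuous_cons_rVl n (v : 'rV[R]_n) :
  continuous (fun t : R => cons_rV (t, v)).
Proof.
apply: continuous_to_rV => i; have [j ->|->] := unliftP ord0 i.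
  rewrite (_ : (fun t => _) = cst (v 0 j)); first exact: cst_continuous.
  by apply/funext => t; rewrite cons_rVS.
rewrite (_ : (fun t => _) = id); first by move=> t; exact: cvg_id.
by apply/funext => t; rewrite cons_rV0.
Qed.

(** Supplies the hypothesis of [derive_line] for the slice at fixed t; [cons_rV_line0] does so for
    the slice at fixed v. *)
Lemma cons_rV_lineS n (t h : R) (v : 'rV[R]_n) j :
  cons_rV (t, h *: delta_mx 0 j + v) =
  h *: delta_mx 0 (lift ord0 j) + cons_rV (t, v).
Proof.
apply/rowP => i; have [k ->|->] := unliftP ord0 i.
  by rewrite cons_rVS [RHS]mxE cons_rVS !mxE (inj_eq lift_inj).
by rewrite cons_rV0 [RHS]mxE cons_rV0 !mxE mulr0 add0r.
Qed.

Lemma cons_rV_line0 n (t h : R) (v : 'rV[R]_n) :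
  cons_rV (h + t, v) = h *: delta_mx 0 ord0 + cons_rV (t, v).
Proof.
apply/rowP => i; have [k ->|->] := unliftP ord0 i.
  by rewrite cons_rVS [RHS]mxE cons_rVS !mxE mulr0 add0r.
by rewrite cons_rV0 [RHS]mxE cons_rV0 !mxE eqxx mulr1.
Qed.

(** When T carries the line through x along u to the line through [T x] along w, with the same
    parameter, the difference quotients coincide. Directional derivatives then transfer without a
    chain rule. *)
Lemma growth_rate_line (V W : normedModType R) (T : V -> W) (f : W -> R)
    x u w : (forall h, T (h *: u + x) = h *: w + T x) ->
  (fun h : R => h^-1 *: (((f \o T) \o shift x) (h *: u) - (f \o T) x)) =
  (fun h : R => h^-1 *: ((f \o shift (T x)) (h *: w) - f (T x))).
Proof. by move=> Tx; apply/funext => h /=; rewrite Tx. Qed.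

Lemma derive_line (V W : normedModType R) (T : V -> W) (f : W -> R) x u w :
  (forall h, T (h *: u + x) = h *: w + T x) ->
  'D_u (f \o T) x = 'D_w f (T x).
Proof. by move=> Tx; rewrite /derive (growth_rate_line f Tx). Qed.

Lemma derivable_line (V W : normedModType R) (T : V -> W) (f : W -> R) x u w :
  (forall h, T (h *: u + x) = h *: w + T x) ->
  derivable f (T x) w -> derivable (f \o T) x u.
Proof. by move=> Tx; rewrite /derivable (growth_rate_line f Tx). Qed.

Lemma integral_derive1_oo (F G : R -> R) (a b : R) : a < b ->
  (forall x, derivable F x 1) -> continuous G -> (forall x, 'D_1 F x = G x) ->
  (\int[lebesgue_measure]_(x in `]a, b[) (G x)%:E = (F b - F a)%:E)%E.
Proof.
move=> ab dF cG FG.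
have cF : continuous F.
  by move=> x; apply/differentiable_continuous/derivable1_diffP; exact: dF.
(* Endpoints are null, so the fundamental theorem on the closed interval applies. *)
rewrite -(@integral_itv_bndoo _ _ _ _ true false); last first.
  apply/measurable_EFinP; apply: measurable_funTS.
  exact: continuous_measurable_fun.
apply: continuous_FTC2 => //; first exact: continuous_subspaceT.
  split; first by move=> x _; exact: dF.
    exact: cvg_at_right_filter (cF a).
  exact: cvg_at_left_filter (cF b).
by move=> x _; rewrite derive1E.
Qed.

End slices.

(** * Fubini's theorem on a box and integrals of periodic derivatives *)

Section periodic.
Context {R : realType}.

Lemma measurable_box d (a b : 'rV[R]_d) : measurable (box a b).
Proof.
rewrite (_ : box a b = \bigcap_(j in [set: 'I_d])
    ((fun x => x 0 j) : 'rV[R]_d -> measurableTypeR R) @^-1`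
      `]a 0 j, b 0 j[%classic).
  apply: fin_bigcap_measurable => // j _.
  rewrite -[X in measurable X]setTI.
  by apply: measurable_coord_rV => //; exact: measurable_itv.
by apply/seteqP; split=> [x + j _|x + j] => /(_ j); rewrite /= in_itv/=; apply.
Qed.

Lemma bounded_box d (a b : 'rV[R]_d) : bounded_set (box a b).
Proof.
have := rV_compact (fun j => @segment_compact R (a 0 j) (b 0 j)).
move=> /compact_bounded[M [Mr KM]]; exists M; split=> // r /KM rK x xab.
by apply: rK => j /=; have /andP[aj bj] := xab j; rewrite in_itv/= !ltW.
Qed.

Lemma continuous_integrable_box d (a b : 'rV[R]_d) (g : 'rV[R]_d -> R) :
  continuous g -> (lebesgue_rV d).-integrable (box a b) (EFin \o g).
Proof.
move=> cg; apply: (within_continuous_integrable_rV (B := closure (box a b))).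
- exact/bounded_set_closure/bounded_box.
- exact: closed_closure.
- exact: measurable_box.
- exact: subset_closure.
- by apply: bounded_lebesgue_rV; [exact: measurable_box|exact: bounded_box].
- exact: continuous_subspaceT.
Qed.

Lemma integrable_cons_rV d (F : 'rV[R]_d.+1 -> \bar R) :
  (lebesgue_rV d.+1).-integrable setT F ->
  (@lebesgue_measure R \x lebesgue_rV d)%E.-integrable setT
    (F \o @cons_rV R d).
Proof.
move=> /integrableP[mF Foo]; apply/integrableP; split.
  by apply: measurableT_comp => //; exact: measurable_cons_rV.
move: Foo; rewrite [X in (X < _)%E -> _]ge0_integral_pushforward//.
- exact: measurable_cons_rV.
- exact: measurableT_comp.
Qed.

(** Change of variables for an image measure: [lebesgue_rV d.+1] is by construction the pushforward
    of a product. This gives access to Fubini's theorem. *)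
Lemma integral_cons_rV d (F : 'rV[R]_d.+1 -> \bar R) :
  (lebesgue_rV d.+1).-integrable setT F ->
  (\int[lebesgue_rV d.+1]_x F x =
   \int[@lebesgue_measure R \x lebesgue_rV d]_p F (cons_rV p))%E.
Proof.
move=> iF; rewrite [LHS]integral_pushforward//.
- exact: measurable_cons_rV.
- by have /integrableP[] := iF.
- exact: integrable_cons_rV.
Qed.

Lemma box_cons_rV d (a b : 'rV[R]_d.+1) t v :
  box a b (cons_rV (t, v)) <-> a 0 ord0 < t < b 0 ord0 /\
  box (\row_j a 0 (lift ord0 j)) (\row_j b 0 (lift ord0 j)) v.
Proof.
split=> [tv|[tab vab] j].
  split=> [|j]; first by have := tv ord0; rewrite cons_rV0.
  by have := tv (lift ord0 j); rewrite cons_rVS !mxE.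
have [k ->|->] := unliftP ord0 j; last by rewrite cons_rV0.
by have := vab k; rewrite cons_rVS !mxE.
Qed.

(* Fubini reduces to integrating along the j-th coordinate first, where the
   fundamental theorem of calculus and periodicity give 0. *)
Lemma integral_partial_periodic d (a b : 'rV[R]_d) (f : 'rV[R]_d -> R) j :
  (forall i, a 0 i < b 0 i) ->
  (forall x, derivable f x (delta_mx 0 j)) -> continuous (partial j f) ->
  (forall x, f (x + (b 0 j - a 0 j) *: delta_mx 0 j) = f x) ->
  (\int[lebesgue_rV d]_(x in box a b) (partial j f x)%:E = 0)%E.
Proof.
elim: d a b f j => [a b f []//|d IH] a b f j ab df cf pf.
set g := partial j f.
(* Extension by zero outside the box turns the integral into one over the whole product space, as
   Fubini's theorem requires. *)
have ig : (lebesgue_rV d.+1).-integrable setT (EFin \o (g \_ (box a b))).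
  rewrite -restrict_EFin; apply/integrable_restrict => //.
    exact: measurable_box.
  by rewrite setTI; exact: continuous_integrable_box.
pose a' := \row_j a 0 (lift ord0 j); pose b' := \row_j b 0 (lift ord0 j).
rewrite integral_mkcond restrict_EFin integral_cons_rV//.
have igc := integrable_cons_rV ig.
have [k jk|j0] := unliftP ord0 j.
(* If j is not the first coordinate, t is frozen and the induction hypothesis kills the integral
   over the slice. *)
- rewrite -(integral12_prod_meas1 igc); apply: integral0_eq => t _.
  rewrite /fubini_F /=.
  have [tab|tab] := boolP (a 0 ord0 < t < b 0 ord0); last first.
    apply: integral0_eq => v _; rewrite patchE memNset// => /box_cons_rV[].
    by rewrite (negPf tab).
  transitivity (\int[lebesgue_rV d]_(v in box a' b')
      (partial k (f \o (fun v => cons_rV (t, v))) v)%:E)%E; last first.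
    apply: IH => [i|v||v].
    + by rewrite !mxE.
    + apply: derivable_line (df _).
      by move=> h; rewrite cons_rV_lineS jk.
    + rewrite (_ : partial _ _ = g \o (fun v => cons_rV (t, v))).
        move=> v; apply: continuous_comp; last exact: cf.
        exact: continuous_cons_rVr.
      apply/funext => v; apply: derive_line => h.
      by rewrite cons_rV_lineS jk.
    + by rewrite /= addrC cons_rV_lineS addrC !mxE -jk pf.
  rewrite [RHS]integral_mkcond; apply: eq_integral => v _.
  rewrite [RHS]patchE patchE; case: ifPn => [/set_mem/box_cons_rV[_ vab]|vab].
    rewrite mem_set//; congr EFin; apply/esym/derive_line => h.
    by rewrite cons_rV_lineS jk.
  rewrite memNset// => v'; move/negP: vab; apply; apply/mem_set.
  exact/box_cons_rV.
(* If j is the first coordinate, v is frozen and the inner integral is the increment of F over one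
   period, which is 0. *)
- rewrite -(integral21_prod_meas1 igc); apply: integral0_eq => v _.
  rewrite /fubini_G /=.
  have [vab|vab] := pselect (box a' b' v); last first.
    by apply: integral0_eq => t _; rewrite patchE memNset// => /box_cons_rV[].
  pose F t := f (cons_rV (t, v)).
  transitivity (\int[lebesgue_measure]_(t in `]a 0%R ord0, b 0%R ord0[)
      (g (cons_rV (t, v)))%:E)%E.
    rewrite [RHS]integral_mkcond; apply: eq_integral => t _.
    rewrite [RHS]patchE patchE.
    case: ifPn => [/set_mem/box_cons_rV[tab _]|tvab].
      by rewrite mem_set//= in_itv.
    rewrite memNset//= in_itv/= => tab; move/negP : tvab; apply; apply/mem_set.
    exact/box_cons_rV.
  have line t h : cons_rV (h *: (1 : R) + t, v) =
      h *: delta_mx 0 j + cons_rV (t, v).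
    by rewrite j0 -cons_rV_line0 /GRing.scale/= mulr1.
  rewrite (@integral_derive1_oo _ F)//.
  + have := pf (cons_rV (a 0 ord0, v)).
    rewrite /F addrC j0 -cons_rV_line0 subrK => ->.
    by rewrite subrr.
  + by move=> t; apply: derivable_line (df _) => h; exact: line.
  + by move=> t; apply: continuous_comp; [exact: continuous_cons_rVl|exact: cf].
  + by move=> t; apply: derive_line => h; exact: line.
Qed.

End periodic.

(** * Boundary fluxes *)

Section integration.
Context {R : realType} {d : nat}.
Implicit Types (Omega : set 'rV[R]_d) (f g w v : 'rV[R]_d -> R).

Lemma domain_measurable Omega : domain Omega -> measurable Omega.
Proof. by case=> _ oO _ _; exact: open_measurable_rV. Qed.

(** The extension is bounded on the compact closure, and Omega has finite volume. *)
Lemma has_extension_integrable Omega f : domain Omega ->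
  has_extension Omega f -> (lebesgue_rV d).-integrable Omega (EFin \o f).
Proof.
move=> domO [g [cg fg]]; have mO := domain_measurable domO.
have [bO _ _ _] := domO.
apply: (@eq_integrable _ _ _ _ _ mO (EFin \o g)).
  by move=> x xO; rewrite /= fg.
apply: (within_continuous_integrable_rV (B := closure Omega)) => //.
- exact: bounded_set_closure.
- exact: closed_closure.
- exact: subset_closure.
- exact: bounded_lebesgue_rV.
Qed.

Lemma Rintegral_sum_extension n Omega (F : 'I_n -> 'rV[R]_d -> R) :
  domain Omega -> (forall i, has_extension Omega (F i)) ->
  \int[lebesgue_rV d]_(x in Omega) (\sum_i F i x) =
  \sum_i \int[lebesgue_rV d]_(x in Omega) F i x.
Proof.
move=> domO; have mO := domain_measurable domO.
elim: n F => [|n IH] F eF.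
  rewrite big_ord0; under eq_Rintegral do rewrite big_ord0.
  by rewrite Rintegral_cst// mul0r.
rewrite big_ord_recr/= -IH; last by move=> i; exact: eF.
under [LHS]eq_Rintegral do rewrite big_ord_recr/=.
rewrite RintegralD//; apply: has_extension_integrable => //.
by apply: has_extension_sum => i; exact: eF.
Qed.

Lemma measurable_boundary Omega : measurable (boundary Omega).
Proof.
apply: measurableD; last by apply: open_measurable_rV; exact: open_interior.
rewrite -[closure _]setCK; apply: measurableC; apply: open_measurable_rV.
by apply: closed_openC; exact: closed_closure.
Qed.

Lemma has_extensionT_continuous f : has_extension setT f -> continuous f.
Proof.
move=> [g [cg fg]]; rewrite (_ : f = g); last first.
  by apply/funext => x; rewrite fg// inE.
by apply/continuous_subspace_setT; rewrite -closureT.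
Qed.

(** Translation by a period maps lines to parallel lines, so it commutes with differentiation. *)
Lemma box_periodic_partial (a b : 'rV[R]_d) f j :
  box_periodic a b f -> box_periodic a b (partial j f).
Proof.
move=> pf x k; rewrite /partial.
pose T (y : 'rV[R]_d) := y + (b 0 k - a 0 k) *: delta_mx 0 k.
have fT : f \o T = f by apply/funext => y; exact: pf.
rewrite -[in RHS]fT -/(T x); apply/esym/derive_line => h.
by rewrite /T addrA.
Qed.

Lemma integral_divergence_periodic (a b : 'rV[R]_d) w v :
  (forall j, a 0 j < b 0 j) -> domain (box a b) ->
  Ck_closure setT 1 w -> box_periodic a b w ->
  Ck_closure setT 2 v -> box_periodic a b v ->
  \int[lebesgue_rV d]_(x in box a b)
    divergence (fun y => w y *: grad v y) x = 0.
Proof.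
move=> ab domO Cw pw Cv pv.
pose F j y := w y * partial j v y.
have dF j x : derivable (F j) x (delta_mx 0 j).
  have [dw _] := Ck_closure_partial j Cw.
  have [_ [_ /(_ j)[dv _]]] := Ck_closure_partial j Cv.
  by apply: derivableM; [exact: dw|exact: dv].
have eF j : has_extension setT (partial j (F j)).
  have [dw [ew _]] := Ck_closure_partial j Cw.
  have [_ [ev /(_ j)[dv [ev' _]]]] := Ck_closure_partial j Cv.
  apply: (@eq_has_extension _ _ _
      (fun x => w x * partial j (partial j v) x +
                partial j v x * partial j w x)).
    by move=> x _; rewrite partialM//; [exact: dw|exact: dv].
  apply: has_extensionD; apply: has_extensionM => //.
  exact: Ck_closure_has_extension Cw.
have cF j := has_extensionT_continuous (eF j).
rewrite (_ : (fun x => _) = fun x => \sum_j partial j (F j) x); last first.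
  apply/funext => x; apply: eq_bigr => j _.
  rewrite (_ : (fun y => _) = F j)//.
  by apply/funext => y; rewrite !mxE.
rewrite Rintegral_sum_extension//; last first.
  move=> j; apply: within_has_extension; exact: continuous_subspaceT.
rewrite big1// => j _; rewrite /Rintegral integral_partial_periodic// => x.
by rewrite /F pw box_periodic_partial.
Qed.

End integration.

(** * Boundary terms and their values under each boundary condition *)

Section flux.
Context {R : realType} {d : nat} (Omega : set 'rV[R]_d).
Implicit Types (f g w v : 'rV[R]_d -> R) (bc : boundary_condition Omega)
  (G : gauss_boundary Omega).

(** The boundary term of Green's formula for div(w grad v). In the periodic case it is set to 0,
    since opposite faces cancel. *)
Definition flux bc w v : R :=
  match bc with
  | Periodic _ _ _ _ => 0
  | NoFlux G _ =>
      \int[surface G]_(x in boundary Omega) (w x * normal_derivative G v x)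
  end.

Lemma regular_Ck_closure bc k f : regular bc k f -> Ck_closure Omega k f.
Proof. by case: bc => [a b _ _ []|//] /Ck_closureT. Qed.

Lemma regularM bc f g : open Omega -> regular bc 1 f -> regular bc 1 g ->
  regular bc 1 (fun x => f x * g x).
Proof.
case: bc => [a b ab Oab|G c] oO /=; last exact: Ck_closure1M.
move=> [Cf pf] [Cg pg]; split; first by apply: Ck_closure1M => //; exact: openT.
by move=> x j; rewrite pf pg.
Qed.

Lemma regularZ bc r f : open Omega -> regular bc 1 f ->
  regular bc 1 (fun x => r * f x).
Proof.
case: bc => [a b ab Oab|G c] oO /=; last exact: Ck_closure1Z.
move=> [Cf pf]; split; first by apply: Ck_closure1Z => //; exact: openT.
by move=> x j; rewrite pf.
Qed.

Lemma regular21 bc f : regular bc 2 f -> regular bc 1 f.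
Proof.
by case: bc => [a b ab Oab [Cf pf]|G c Cf]; [split=> //|]; exact: Ck_closure21.
Qed.

(** Without periodicity, Gauss's theorem is applied to w times the continuous extension of grad v, a
    C^1 field up to the boundary with the same divergence in Omega. *)
Lemma integral_divergence_flux bc w v : domain Omega ->
  regular bc 1 w -> regular bc 2 v ->
  \int[lebesgue_rV d]_(x in Omega) divergence (fun y => w y *: grad v y) x =
  flux bc w v.
Proof.
move=> domO; have oO : open Omega by case: domO.
case: bc => [a b ab Oab [Cw pw] [Cv pv]|G c Cw Cv] /=.
  by move: domO; rewrite Oab => domO; exact: integral_divergence_periodic.
transitivity (\int[surface G]_(x in boundary Omega)
    dotp (w x *: grad_closure Omega v x) (normal G x)); last first.
  by apply: eq_Rintegral => x _; rewrite dotpZl.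
rewrite -(divergence_theorem G (F := fun x => w x *: grad_closure Omega v x)).
  apply: eq_Rintegral => x /set_mem Ox.
  apply: (eq_divergence_open oO) => // y Oy; congr (_ *: _).
  apply/rowP => j; rewrite !mxE extend_in//.
  exact: Ck_closure_partial_extension Cv.
move=> j; rewrite (_ : (fun x => _) =
    fun x => w x * extend Omega (partial j v) x); last first.
  by apply/funext => x; rewrite !mxE.
by apply: Ck_closure1M => //; exact: Ck_closure_extend_partial.
Qed.

Lemma measurable_within_boundary f : {within closure Omega, continuous f} ->
  measurable_fun (boundary Omega) f.
Proof.
move=> cf; apply: within_continuous_measurable_rV.
  exact: measurable_boundary.
by apply: continuous_subspaceW cf; exact: subDsetl.
Qed.

Lemma measurable_flux_integrand G w v :
  Ck_closure Omega 1 w -> Ck_closure Omega 2 v ->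
  measurable_fun (boundary Omega)
    (EFin \o (fun x => w x * normal_derivative G v x)).
Proof.
move=> [cw _] Cv; apply/measurable_EFinP.
apply: measurable_funM; first exact: measurable_within_boundary.
rewrite /normal_derivative /dotp; apply: measurable_sum => j.
apply: measurable_funM.
  apply: (eq_measurable_fun (extend Omega (partial j v))).
    by move=> x _; rewrite mxE.
  apply: measurable_within_boundary; apply: extend_within.
  exact: Ck_closure_partial_extension Cv.
apply: measurable_funTS.
apply: (measurableT_comp (measurable_coord_rV j)); exact: measurable_normal.
Qed.

(** Boundary conditions hold only surface-almost everywhere, so they are used under the integral
    sign, for which both integrands must be measurable. *)
Lemma flux_ae G c w v g : Ck_closure Omega 1 w -> Ck_closure Omega 2 v ->
  {within closure Omega, continuous g} ->
  {ae surface G, forall x, boundary Omega x -> normal_derivative G v x = g x} ->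
  flux (NoFlux G c) w v = \int[surface G]_(x in boundary Omega) (w x * g x).
Proof.
move=> Cw Cv cg vg; rewrite /flux /Rintegral; congr fine.
apply: ae_eq_integral.
- exact: measurable_boundary.
- exact: measurable_flux_integrand.
- apply/measurable_EFinP; apply: measurable_funM.
    exact: measurable_within_boundary Cw.1.
  exact: measurable_within_boundary.
- by apply: filterS vg => x + bx => /(_ bx) /= ->.
Qed.

Lemma flux_ae0 G c w v : Ck_closure Omega 1 w -> Ck_closure Omega 2 v ->
  {ae surface G, forall x, boundary Omega x -> normal_derivative G v x = 0} ->
  flux (NoFlux G c) w v = 0.
Proof.
move=> Cw Cv v0; rewrite (@flux_ae G c w v (fun=> 0))//.
  under eq_Rintegral do rewrite mulr0.
  by rewrite Rintegral_cst ?mul0r//; exact: measurable_boundary.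
by move=> x; exact: cvg_cst.
Qed.

Lemma flux_mu bc w v : regular bc 1 w -> regular bc 2 v ->
  mu_condition bc v -> flux bc w v = 0.
Proof. by case: bc => [//|G c] Cw Cv v0; exact: flux_ae0. Qed.

Lemma integrable_boundary G f : bounded_set Omega ->
  {within closure Omega, continuous f} ->
  (surface G).-integrable (boundary Omega) (EFin \o f).
Proof.
move=> bO; apply: within_continuous_integrable_rV.
- exact: bounded_set_closure.
- exact: closed_closure.
- exact: measurable_boundary.
- exact: subDsetl.
- rewrite -ge0_fin_numE ?measure_ge0//; apply: fin_num_measure.
  exact: measurable_boundary.
Qed.

(** Here the weight vanishes, whatever the normal derivative of v. *)
Lemma flux_dirichlet G c w v : (forall x, boundary Omega x -> w x = 0) ->
  flux (NoFlux G c) w v = 0.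
Proof.
move=> w0; rewrite -[RHS](mul0r (fine (surface G (boundary Omega)))).
rewrite -Rintegral_cst; last exact: measurable_boundary.
by apply: eq_Rintegral => x /set_mem bx; rewrite w0// mul0r.
Qed.

(** The Robin condition, solved for the normal derivative, gives -(alpha/beta) v almost everywhere
    on the boundary. *)
Lemma flux_robin G c (alpha beta : R) w v : 0 < beta ->
  domain Omega -> Ck_closure Omega 1 w -> Ck_closure Omega 2 v ->
  {ae surface G, forall x, boundary Omega x ->
    alpha * v x + beta * normal_derivative G v x = 0} ->
  flux (NoFlux G c) w v =
  - (alpha / beta) * \int[surface G]_(x in boundary Omega) (w x * v x).
Proof.
move=> beta0 [bO oO _ _] Cw Cv vbc; set k := alpha / beta.
rewrite (@flux_ae G c w v (fun x => - k * v x))//.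
- rewrite -RintegralZl.
  + by apply: eq_Rintegral => x _; rewrite mulrCA.
  + exact: measurable_boundary.
  + apply: integrable_boundary => // x.
    exact: (continuousM (Cw.1 x) (Cv.1 x)).
- exact: (Ck_closure1Z (- k) oO (Ck_closure21 Cv)).1.
- apply: filterS vbc => x + bx => /(_ bx) /eqP; rewrite addr_eq0 => /eqP e.
  by rewrite mulNr /k mulrAC e mulNr opprK mulrC mulKf// gt_eqF.
Qed.

(** Here p stands for the old potential and q for the new one. As both obey the same condition, the
    three Robin fluxes share the factor -(alpha/beta), and the integrands combine to the square of q
    - p. In the other cases each flux is 0. *)
Lemma flux_phi_le0 bc p q : domain Omega ->
  regular bc 2 p -> regular bc 2 q ->
  phi_condition bc p -> phi_condition bc q ->
  flux bc q q - 2 * flux bc q p + flux bc p p <= 0.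
Proof.
have zero (A B C : R) : A = 0 -> B = 0 -> C = 0 -> A - 2 * B + C <= 0.
  by move=> -> -> ->; rewrite mulr0 subr0 addr0.
move=> domO rp rq; have [bO _ _ _] := domO.
have := (regular21 rp, regular21 rq).
case: bc rp rq => [a b ab Oab|G c] Cp Cq [C1p C1q].
  by move=> _ _; exact: zero.
case: c Cp Cq C1p C1q => [||alpha beta alpha0 beta0] Cp Cq C1p C1q cp cq.
- by apply: zero; exact: flux_dirichlet.
- have [p0 _] := cp; have [q0 _] := cq.
  exact: (zero _ _ _ (flux_ae0 Neumann C1q Cq q0) (flux_ae0 Neumann C1q Cp p0)
    (flux_ae0 Neumann C1p Cp p0)).
- have robin := @flux_robin G (Robin alpha0 beta0) alpha beta _ _ beta0 domO.
  have comb (A B C k I J K : R) : A = - k * I -> B = - k * J -> C = - k * K ->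
      0 <= k -> 0 <= I - 2 * J + K -> A - 2 * B + C <= 0.
    move=> -> -> -> k0 IJK.
    rewrite (_ : - k * I - _ + _ = - (k * (I - 2 * J + K))).
      by rewrite oppr_le0 mulr_ge0.
    by ring.
  apply: (comb _ _ _ _ _ _ _ (robin _ _ C1q Cq cq) (robin _ _ C1q Cp cp)
    (robin _ _ C1p Cp cp)); first by rewrite divr_ge0// ltW.
  have int f g : {within closure Omega, continuous f} ->
      {within closure Omega, continuous g} ->
      (surface G).-integrable (boundary Omega) (EFin \o (fun x => f x * g x)).
    move=> cf cg; apply: integrable_boundary => // x.
    exact: (continuousM (cf x) (cg x)).
  have mb := measurable_boundary Omega.
  have [cp0 cq0] := (Cp.1, Cq.1).
  have iqq := int _ _ cq0 cq0; have iqp := int _ _ cq0 cp0.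
  have ipp := int _ _ cp0 cp0.
  have i2 : (surface G).-integrable (boundary Omega)
      (EFin \o (fun x => 2 * (q x * p x))).
    exact: (integrableZl mb 2 iqp).
  rewrite -RintegralZl// -RintegralB// -RintegralD//; last first.
    exact: (integrableB mb iqq i2).
  apply: Rintegral_ge0 => x _.
  rewrite (_ : _ + _ = (q x - p x) ^+ 2); first exact: sqr_ge0.
  by ring.
Qed.

End flux.

(** * The energy estimate *)

Section extension_integral.
Context {R : realType} {d : nat} (Omega : set 'rV[R]_d) (domO : domain Omega).
Implicit Types f g u w v : 'rV[R]_d -> R.

Let mO : measurable Omega := domain_measurable domO.

Lemma RintegralD_extension f g : has_extension Omega f ->
  has_extension Omega g ->
  \int[lebesgue_rV d]_(x in Omega) (f x + g x) =
  \int[lebesgue_rV d]_(x in Omega) f x + \int[lebesgue_rV d]_(x in Omega) g x.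
Proof.
by move=> ef eg; apply: RintegralD => //; exact: has_extension_integrable.
Qed.

Lemma RintegralB_extension f g : has_extension Omega f ->
  has_extension Omega g ->
  \int[lebesgue_rV d]_(x in Omega) (f x - g x) =
  \int[lebesgue_rV d]_(x in Omega) f x - \int[lebesgue_rV d]_(x in Omega) g x.
Proof.
by move=> ef eg; apply: RintegralB => //; exact: has_extension_integrable.
Qed.

Lemma RintegralZl_extension r f : has_extension Omega f ->
  \int[lebesgue_rV d]_(x in Omega) (r * f x) =
  r * \int[lebesgue_rV d]_(x in Omega) f x.
Proof.
by move=> ef; apply: RintegralZl => //; exact: has_extension_integrable.
Qed.

Lemma le_Rintegral_extension f g : has_extension Omega f ->
  has_extension Omega g -> (forall x, Omega x -> f x <= g x) ->
  \int[lebesgue_rV d]_(x in Omega) f x <= \int[lebesgue_rV d]_(x in Omega) g x.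
Proof.
by move=> ef eg; apply: le_Rintegral => //; exact: has_extension_integrable.
Qed.

Lemma has_extension_divergence w v : Ck_closure Omega 1 w ->
  Ck_closure Omega 2 v ->
  has_extension Omega (divergence (fun y => w y *: grad v y)).
Proof.
move=> Cw Cv.
apply: (@eq_has_extension _ _ _
    (fun x => w x * laplacian v x + dotp (grad w x) (grad v x))).
  by move=> x Ox; rewrite (divergence_scale_grad Cw Cv Ox).
apply: has_extensionD.
  apply: has_extensionM; first exact: Ck_closure_has_extension Cw.
  exact: has_extension_laplacian.
by apply: has_extension_dotp_grad => //; exact: Ck_closure21.
Qed.

(** The pointwise form of testing with u: taken at u = v = mu and w = D c, it trades mu times the
    divergence in the scheme for a full divergence minus the dissipation density. *)
Lemma divergence_mul_scale_grad u w v x : Ck_closure Omega 1 u ->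
  Ck_closure Omega 1 w -> Ck_closure Omega 2 v -> Omega x ->
  divergence (fun y => (u y * w y) *: grad v y) x =
  u x * divergence (fun y => w y *: grad v y) x +
  w x * dotp (grad u x) (grad v x).
Proof.
move=> Cu Cw Cv Ox; have [_ oO _ _] := domO.
rewrite (divergence_scale_grad (Ck_closure1M oO Cu Cw) Cv Ox).
rewrite (divergence_scale_grad Cw Cv Ox) mulrDr mulrA -addrA; congr (_ + _).
rewrite /dotp !mulr_sumr -big_split/=; apply: eq_bigr => j _.
have [du _] := Ck_closure_partial j Cu; have [dw _] := Ck_closure_partial j Cw.
rewrite !mxE partialM; [|exact: du|exact: dw].
by ring.
Qed.

Lemma divergence_Z_grad (eps : R) v x : Ck_closure Omega 2 v -> Omega x ->
  divergence (fun y => eps *: grad v y) x = eps * laplacian v x.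
Proof.
move=> Cv Ox; rewrite /laplacian mulr_sumr; apply: eq_bigr => j _.
rewrite (_ : (fun y => _) = eps \*: partial j v).
  have [_ [_ /(_ j)[dv _]]] := Ck_closure_partial j Cv.
  by rewrite /partial deriveZ//; exact: dv.
by apply/funext => y; rewrite !mxE.
Qed.

End extension_integral.

(** The convex function s (ln s - 1) lies above its tangent at y. Concretely, this is 1 + t <= exp t
    at t = ln y - ln x, multiplied by x. *)
Lemma entropy_le (R : realType) (x y : R) : 0 < x -> 0 < y ->
  y * (ln y - 1) - x * (ln x - 1) <= (y - x) * ln y.
Proof.
move=> x0 y0.
have : x * (1 + (ln y - ln x)) <= y.
  apply: (@le_trans _ _ (x * expR (ln y - ln x))).
    by apply: ler_wpM2l; [exact: ltW|exact: expR_ge1Dx].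
  by rewrite expRB !lnK ?posrE// mulrC divfK// gt_eqF.
by nra.
Qed.

Theorem theorem3p1 (R : realType) (d N : nat) (Omega : set 'rV[R]_d)
    (bc : boundary_condition Omega)
    (z D : 'I_N -> R) (eps rho0 dt : R) (phie : 'rV[R]_d -> R)
    (c mu : nat -> 'I_N -> 'rV[R]_d -> R) (phi : nat -> 'rV[R]_d -> R)
    (n : nat) :
  (1 <= d <= 3)%N -> (1 <= N)%N ->
  domain Omega ->
  (forall i, 0 < D i) -> 0 < eps -> 0 < dt ->
  {within closure Omega, continuous phie} ->
  (exists M, forall x, closure Omega x -> `|phie x| <= M) ->
  (forall i, regular bc 1 (c n i)) ->
  (forall i x, closure Omega x -> 0 < c n i x) ->
  regular bc 2 (phi n) ->
  regular bc 2 (phi n.+1) ->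
  (forall i, regular bc 2 (mu n.+1 i)) ->
  (forall i, mu_condition bc (mu n.+1 i)) ->
  phi_condition bc (phi n) ->
  phi_condition bc (phi n.+1) ->
  (neutrality_required bc -> neutral Omega rho0 z (c n)) ->
  poisson Omega eps rho0 z (c n) (phi n) ->
  (forall i x, Omega x ->
     (c n.+1 i x - c n i x) / dt =
     divergence (fun y => (D i * c n i y) *: grad (mu n.+1 i) y) x) ->
  (forall i x, Omega x ->
     exists2 l, is_log (c n.+1 i x) l &
                mu n.+1 i x = l + z i * (phi n.+1 x + phie x)) ->
  poisson Omega eps rho0 z (c n.+1) (phi n.+1) ->
  [/\ (forall i, \int[lebesgue_rV d]_(x in Omega) c n.+1 i x =
                 \int[lebesgue_rV d]_(x in Omega) c n i x),
      (forall i x, Omega x -> 0 < c n.+1 i x) &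
      energy Omega rho0 z phie (c n.+1) (phi n.+1) -
      energy Omega rho0 z phie (c n) (phi n) <=
      - dt * \int[lebesgue_rV d]_(x in Omega)
        (\sum_i D i * c n i x *
           dotp (grad (mu n.+1 i) x) (grad (mu n.+1 i) x))].
Proof.
move=> _ _ domO D0 eps0 dt0 cphie _ rc c0 rp rp' rmu bmu bp bp' _ pois step ceq
  pois'.
have oO : open Omega by case: domO.
have mO := domain_measurable domO.
set I := fun f : 'rV[R]_d -> R => \int[lebesgue_rV d]_(x in Omega) f x.
(* Solving the definition of the chemical potential for the new concentration; the exponential gives
   positivity, and later regularity. *)
have c'E i x : Omega x ->
    c n.+1 i x = expR (mu n.+1 i x - z i * (phi n.+1 x + phie x)).
  by move=> Ox; have [l <- ->] := ceq i x Ox; rewrite addrK.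
have c'0 i x : Omega x -> 0 < c n.+1 i x.
  by move=> Ox; rewrite c'E// expR_gt0.
have Cc i := regular_Ck_closure (rc i).
have Cmu i := regular_Ck_closure (rmu i).
have Cp := regular_Ck_closure rp; have Cp' := regular_Ck_closure rp'.
have rDc i : regular bc 1 (fun x => D i * c n i x) by exact: regularZ.
have CDc i := regular_Ck_closure (rDc i).
have ec i := Ck_closure_has_extension (Cc i).
have emu i := Ck_closure_has_extension (Cmu i).
have ep := Ck_closure_has_extension Cp.
have ep' := Ck_closure_has_extension Cp'.
have ephie := within_has_extension cphie.
(* This exponent is log c at the new level. Its extension provides those of the new concentration
   and of its logarithm, on which the scheme itself puts no regularity. *)
have el i : has_extension Omega
    (fun x => mu n.+1 i x - z i * (phi n.+1 x + phie x)).
  by apply: has_extensionB => //; apply: has_extensionZ; exact: has_extensionD.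
have elnc i : has_extension Omega (fun x => ln (c n i x)).
  by apply: has_extension_ln; [exact: (Cc i).1|exact: c0].
have elnc' i : has_extension Omega (fun x => ln (c n.+1 i x)).
  apply: eq_has_extension (el i) => x Ox.
  by rewrite (c'E i x Ox) expRK.
have ec' i : has_extension Omega (c n.+1 i).
  apply: eq_has_extension (has_extension_comp (@continuous_expR R) (el i)).
  by move=> x Ox; rewrite (c'E i x Ox).
pose J i := divergence (fun y => (D i * c n i y) *: grad (mu n.+1 i) y).
have eJ i : has_extension Omega (J i).
  exact: has_extension_divergence (CDc i) (Cmu i).
have c'B i x : Omega x -> c n.+1 i x - c n i x = dt * J i x.
  by move=> Ox; rewrite /J -step// mulrC divfK// gt_eqF.
split=> [i|//|].
  (* The change of mass is dt times the integral of [J i], a flux that vanishes by the condition on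
     mu. *)
  apply/eqP; rewrite -subr_eq0.
  rewrite -(RintegralB_extension domO (ec' i) (ec i)).
  rewrite (_ : Rintegral _ _ _ = I (fun x => dt * J i x)); last first.
    by apply: eq_Rintegral => x /set_mem Ox; exact: c'B.
  rewrite /I (RintegralZl_extension domO dt (eJ i)).
  rewrite (integral_divergence_flux domO (rDc i) (rmu i)).
  by rewrite (flux_mu (rDc i) (rmu i) (bmu i)) mulr0.
pose e k x := \sum_i c k i x * (ln (c k i x) - 1) +
  (rho0 + \sum_i z i * c k i x) * (2^-1 * phi k x + phie x).
have ext_e k : (forall i, has_extension Omega (c k i)) ->
    (forall i, has_extension Omega (fun x => ln (c k i x))) ->
    has_extension Omega (phi k) -> has_extension Omega (e k).
  move=> eck elnck epk; apply: has_extensionD.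
    apply: has_extension_sum => i; apply: has_extensionM => //.
    by apply: has_extensionB => //; exact: has_extension_cst.
  apply: has_extensionM.
    apply: has_extensionD; first exact: has_extension_cst.
    by apply: has_extension_sum => i; exact: has_extensionZ.
  by apply: has_extensionD => //; exact: has_extensionZ.
have ee := ext_e n ec elnc ep; have ee' := ext_e n.+1 ec' elnc' ep'.
pose diss x := \sum_i D i * c n i x *
  dotp (grad (mu n.+1 i) x) (grad (mu n.+1 i) x).
(* [K i] equals mu times [J i] plus the i-th dissipation density, and integrates to 0 by the
   condition on mu. *)
pose K i := divergence
  (fun y => (mu n.+1 i y * (D i * c n i y)) *: grad (mu n.+1 i) y).
(* The arguments of Q are time levels; q is the divergence whose boundary terms [flux_phi_le0]
   controls. *)
pose Q w v := divergence (fun y => phi w y *: grad (phi v) y).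
pose q x := Q n.+1 n.+1 x - 2 * Q n.+1 n x + Q n n x.
have rmu1 i := regular21 (rmu i).
have rmuDc i := regularM oO (rmu1 i) (rDc i).
have eK i : has_extension Omega (K i).
  exact: has_extension_divergence (regular_Ck_closure (rmuDc i)) (Cmu i).
have rp1 := regular21 rp; have rp1' := regular21 rp'.
have Cp1 := regular_Ck_closure rp1; have Cp1' := regular_Ck_closure rp1'.
have eQ11 : has_extension Omega (Q n.+1 n.+1).
  exact: has_extension_divergence Cp1' Cp'.
have eQ10 : has_extension Omega (Q n.+1 n).
  exact: has_extension_divergence Cp1' Cp.
have eQ00 : has_extension Omega (Q n n).
  exact: has_extension_divergence Cp1 Cp.
have e2Q10 : has_extension Omega (fun x => 2 * Q n.+1 n x).
  exact: has_extensionZ eQ10.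
have eQB : has_extension Omega (fun x => Q n.+1 n.+1 x - 2 * Q n.+1 n x).
  exact: has_extensionB eQ11 e2Q10.
have eq_ : has_extension Omega q by exact: has_extensionD eQB eQ00.
have ediss : has_extension Omega diss.
  apply: has_extension_sum => i; apply: has_extensionM.
    exact: Ck_closure_has_extension (CDc i).
  exact: has_extension_dotp_grad (Ck_closure21 (Cmu i)) (Ck_closure21 (Cmu i)).
have eKsum : has_extension Omega (fun x => \sum_i K i x).
  exact: has_extension_sum eK.
(* A pointwise majorant of the energy density increment, made of divergences apart from the
   dissipation. The estimate is thus proved pointwise and integrated once. *)
pose T x := dt * (\sum_i K i x - diss x) + eps / 2 * q x.
have eKB : has_extension Omega (fun x => \sum_i K i x - diss x).
  exact: has_extensionB eKsum ediss.
have edK := has_extensionZ dt eKB; have eeq := has_extensionZ (eps / 2) eq_.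
have eT : has_extension Omega T by exact: has_extensionD edK eeq.
have le_eT x : Omega x -> e n.+1 x - e n x <= T x.
  move=> Ox; have xp := pois x Ox; have xp' := pois' x Ox.
  have Kx i : K i x = mu n.+1 i x * J i x +
      D i * c n i x * dotp (grad (mu n.+1 i) x) (grad (mu n.+1 i) x).
    exact (divergence_mul_scale_grad domO (Ck_closure21 (Cmu i)) (CDc i)
      (Cmu i) Ox).
  rewrite /e /T /q /diss /Q.
  set rho := rho0 + _ in xp *; set rho' := rho0 + _ in xp' *.
  rewrite (divergence_Z_grad eps Cp Ox) in xp.
  rewrite (divergence_Z_grad eps Cp' Ox) in xp'.
  rewrite (divergence_scale_grad Cp1' Cp' Ox).
  rewrite (divergence_scale_grad Cp1' Cp Ox).
  rewrite (divergence_scale_grad Cp1 Cp Ox) -sumrB.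
  set S' := \sum_i _; set S := \sum_i _; set L := \sum_i _.
  (* Convexity bounds the entropy increment by the sum of (c' - c) log c'. With log c' = mu - z
     (phi' + phie) and c' - c = dt J, the mu part gives dt L, and the z-weighted sum is the charge
     increment. *)
  have SS : S' - S <= dt * L - (rho' - rho) * (phi n.+1 x + phie x).
    rewrite (_ : _ - _ * _ = \sum_i (c n.+1 i x - c n i x) * ln (c n.+1 i x)).
      rewrite /S' /S -sumrB; apply: ler_sum => i _; apply: entropy_le.
        by apply: c0; exact: subset_closure.
      exact: c'0.
    rewrite /L /rho /rho' opprD addrACA subrr add0r -sumrB mulr_sumr mulr_suml.
    rewrite -sumrB; apply: eq_bigr => i _.
    rewrite Kx (c'E i x Ox) expRK -(c'E i x Ox) -mulrBr c'B//.
    by ring.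
  (* The term eps/2 |grad (phi' - phi)|^2 is exactly the slack left once [SS] is used. *)
  have := dotp_ge0 (grad (phi n.+1) x - grad (phi n) x).
  rewrite dotpBB => d0.
  have {d0} := mulr_ge0 (divr_ge0 (ltW eps0) (ler0n R 2)) d0.
  move: SS xp xp'.
  move: (dotp _ _) (dotp _ _) (dotp _ _) (laplacian _ _) (laplacian _ _).
  move: (phi n x) (phi n.+1 x) (phie x) => p p' pe A B C lp lp'.
  move: S S' L rho rho' => S S' L rho rho' SS xp xp' d0.
  (* With the charges written as -eps times the Laplacians, the goal is the sum of [SS] and [d0],
     linear in the monomials. *)
  rewrite -xp -xp' in SS *.
  lra.
have IK : I (fun x => \sum_i K i x) = 0.
  rewrite /I (Rintegral_sum_extension domO eK) big1// => i _.
  rewrite (integral_divergence_flux domO (rmuDc i) (rmu i)).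
  exact: flux_mu (rmuDc i) (rmu i) (bmu i).
have Iq : I q <= 0.
  have comb (A B C A' B' C' : R) : A = A' -> B = B' -> C = C' ->
      A' - 2 * B' + C' <= 0 -> A - 2 * B + C <= 0 by move=> -> -> ->.
  rewrite /I /q (RintegralD_extension domO eQB eQ00).
  rewrite (RintegralB_extension domO eQ11 e2Q10).
  rewrite (RintegralZl_extension domO 2 eQ10).
  exact (comb _ _ _ _ _ _ (integral_divergence_flux domO rp1' rp')
    (integral_divergence_flux domO rp1' rp)
    (integral_divergence_flux domO rp1 rp)
    (flux_phi_le0 domO rp rp' bp bp')).
(* The [K i] drop out by [IK]; the remaining q term is nonpositive by [Iq]. *)
have IT : I T = - dt * I diss + eps / 2 * I q.
  rewrite /I (RintegralD_extension domO edK eeq).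
  rewrite (RintegralZl_extension domO dt eKB).
  rewrite (RintegralZl_extension domO (eps / 2) eq_).
  rewrite (RintegralB_extension domO eKsum ediss).
  by rewrite [X in dt * (X - _)]IK sub0r mulrN mulNr.
rewrite /energy -/(e n) -/(e n.+1).
rewrite -[X in X <= _](RintegralB_extension domO ee' ee).
apply: (@le_trans _ _ (I T)).
  exact (le_Rintegral_extension domO (has_extensionB ee' ee) eT le_eT).
rewrite IT gerDl pmulr_rle0// divr_gt0//.
Qed.
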